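(* Let $S$ be a 2-dimensional simplicial complex and let $\epsilon>0$. Then for all sufficiently large $k$, every subcomplex $T$ of $\mathfrak{s}^k S$ satisfies 1. $\mu_1(T)>\frac13-\epsilon$ (whenever $f_1(T)\neq 0$, so that $\mu_1(T)$ is defined); 2. $\mu_2(T)>\frac12-\epsilon$ (whenever $f_2(T)\neq 0$, so that $\mu_2(T)$ is defined).
   Context: All simplicial complexes are finite. For a simplicial complex $T$ of dimension at most $2$, $f_i(T)$ ($i=0,1,2$) is the number of simplices of dimension $i$ in $T$, and $\mu_i(T)=\frac{f_0(T)}{f_i(T)}$ for $i=1,2$, defined whenever $f_i(T)\ne 0$. For a 2-complex $S$ and $k\ge1$, $\mathfrak{s}^kS$ denotes the following $k$-fold subdivision of $S$: $\mathfrak{s}^1S$ is the barycentric subdivision of $S$, and for $k\ge 1$, $\mathfrak{s}^{k+1}S$ is obtained from $\mathfrak{s}^kS$ by bisecting every edge at its midpoint and dividing every triangle into four triangles by joining the midpoints of its three edges. (So each 2-simplex of $S$ is divided into $6\cdot 4^{k-1}$ triangles.) *)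

(* Defs.v *)
From HB Require Import structures.
From mathcomp Require Import all_boot all_order all_algebra.
From mathcomp Require Import reals.

Set Implicit Arguments.
Unset Strict Implicit.
Unset Printing Implicit Defensive.

Import Order.TTheory GRing.Theory Num.Theory.

(* The empty set is not counted as a simplex, and a point of V is a vertex of
   K only when its singleton belongs to K. *)
Definition is_complex (V : finType) (K : {set {set V}}) : Prop :=
  set0 \notin K /\
  forall s t : {set V}, s \in K -> t \subset s -> t != set0 -> t \in K.

Definition has_dim (V : finType) (d : nat) (K : {set {set V}}) : Prop :=
  (forall s, s \in K -> #|s| <= d.+1) /\ exists2 s, s \in K & #|s| = d.+1.

Definition subcomplex (V : finType) (T K : {set {set V}}) : Prop :=
  is_complex T /\ T \subset K.

(* Vertices are the simplices of K (their barycentres); simplices are the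
   nonempty flags. *)
Definition barycentric (V : finType) (K : {set {set V}}) : {set {set {set V}}} :=
  [set A : {set {set V}} | [&& A != set0, A \subset K &
     [forall s in A, forall t in A, (s \subset t) || (t \subset s)]]].

(* In the midpoint subdivision the old vertex v is encoded as [set v] and the
   midpoint of the edge {v, w} as [set v; w].  For a triangle s = {u, v, w},
   [corner s v] is the small triangle with vertices v and the midpoints of
   {u, v} and {v, w}, and [medial s] is the central one; for an edge s,
   [corner s v] is the half-edge at v, and for a vertex it is that vertex. *)
Definition corner (V : finType) (s : {set V}) (v : V) : {set {set V}} :=
  [set e : {set V} | [&& v \in e, e \subset s & #|e| <= 2]].

Definition medial (V : finType) (s : {set V}) : {set {set V}} :=
  [set e : {set V} | (e \subset s) && (#|e| == 2)].

(* Only meaningful when K has dimension at most 2. *)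
Definition midpoint_subdivision (V : finType) (K : {set {set V}}) :
    {set {set {set V}}} :=
  [set A : {set {set V}} | (A != set0) &&
     [exists s in K,
        [exists v in s, A \subset corner s v] || (A \subset medial s)]].

Fixpoint iterset (V : finType) (k : nat) : finType :=
  if k is k'.+1 then {set iterset V k'} else V.

(* The value S at k = 0 is a convention. *)
Fixpoint subdivision (V : finType) (S : {set {set V}}) (k : nat) :
    {set {set iterset V k}} :=
  match k with
  | 0 => S
  | k'.+1 =>
      (if k' is 0 then @barycentric else @midpoint_subdivision) _
        (subdivision S k')
  end.

Definition face_number (V : finType) (i : nat) (T : {set {set V}}) : nat :=
  #|[set s in T | #|s| == i.+1]|.

Local Open Scope ring_scope.

Definition mu (R : realType) (V : finType) (i : nat) (T : {set {set V}}) : R :=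
  (face_number 0 T)%:R / (face_number i T)%:R.

(* Main.v *)
Require Import Defs.
From mathcomp Require Import all_boot all_order all_algebra.
From mathcomp Require Import reals.
From mathcomp Require Import zify lra.

(** Write N = 2 ^ k and subdivide S k + 1 times. A vertex of the first
    (barycentric) subdivision is a simplex of S; give it its indicator function
    as coordinates. At each later step a midpoint gets the sum of the coordinates
    of the two ends of its edge, and an old vertex gets twice its former
    coordinates. In this way the vertices of the final subdivision become
    functions on the vertices of S with maximum N and support in S, and its
    simplices become chains n1 <= n2 <= n3 <= n1 + 1 sharing a coordinate equal
    to N ([is_chain], [subdivision_coord]). Over a triangle abc of S, the
    differences of the three coordinates turn these points into a regular
    hexagon of side N in the triangular lattice. Lattice lines of each of the
    three directions sweep the hexagon, and except for the sides of the hexagon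
    every one of them has more than N steps.

    The engine is a count on a path with L > N steps ([path_count]). Let Q be a
    set of points of the path. If Q misses an inner point, then every step with
    both ends in Q can be charged to its end closer to that point, so there are
    no more such steps than inner points of Q; if Q misses none, there are at
    most L steps for L - 1 inner points. In both cases the number of steps is at
    most (N + 1) / N times the number of inner points.

    Sort the simplices of T by their carrier, the simplex of S whose interior
    contains theirs. With a triangle abc as carrier, an edge lies on a line which
    is not a side of the hexagon, and the inner points of that line are vertices
    with carrier abc. Summing over the lines of one direction ([direction_count])
    and then over the three directions gives f_1 <= 3 (N + 1) / N f_0 for each
    carrier ([edge_count]). For f_2, cut the hexagon into the strips between
    consecutive lines of a single direction. A triangle of T is a step between
    the two of its edges that cross the strip. The midpoints of the edges
    crossing a strip lie on one line of the next subdivision, so the same count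
    one level up bounds the triangles by the edges of the two other directions,
    hence by 2 ((N + 1) / N)^2 f_0 ([triangle_count]). The bounds for the
    different carriers involve disjoint sets of simplices and simply add up,
    however many triangles of S meet along an edge. *)

Import Order.TTheory GRing.Theory Num.Theory.

Set Implicit Arguments.
Unset Strict Implicit.
Unset Printing Implicit Defensive.

Local Open Scope nat_scope.

(** * Points on long paths *)

(** If an inner point m of the path is missing, charge the steps before m to
    their right end and those after m to their left end: the points charged are
    inner and distinct. If none is missing, L <= (1 + 1 / N) (L - 1) suffices. *)
Lemma path_count (Q : pred nat) (N L : nat) : N < L ->
  N * \sum_(0 <= i < L) (Q i && Q i.+1) <= N.+1 * \sum_(1 <= i < L) Q i.
Proof.
move=> ltNL.
have [allQ | /allPn[m]] := boolP (all Q (iota 1 (L - 1))).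
  have ->: \sum_(1 <= i < L) Q i = L - 1.
    rewrite big_seq_cond (eq_bigr (fun=> 1)) => [|i].
      by rewrite -big_seq_cond sum_nat_const_nat muln1.
    rewrite andbT mem_index_iota => /andP[i_gt0 ltiL].
    by rewrite (allP allQ) // mem_iota; lia.
  have: \sum_(0 <= i < L) (Q i && Q i.+1) <= L.
    rewrite -[X in _ <= X]muln1 -[X in _ <= X * _]subn0 -sum_nat_const_nat.
    by apply: leq_sum => i _; apply: leq_b1.
  by nia.
rewrite mem_iota => m_range notQm; apply: leq_mul => //.
case: m => [|m] in m_range notQm *; first by lia.
have ltmL: m.+1 < L by lia.
rewrite (@big_cat_nat _ _ _ m.+1) ?(ltnW ltmL) //=.
rewrite [X in _ <= X](@big_cat_nat _ _ _ m.+1) ?(ltnW ltmL) //=.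
apply: leq_add; last by apply: leq_sum => i _; case: (Q i); case: (Q i.+1).
rewrite big_nat_recr // (negPf notQm) andbF /= addn0 big_add1 /=.
by apply: leq_sum => i _; case: (Q i).
Qed.

(** The lines with at most N steps are meant to be those along the boundary of the
    region considered, whose edges are left out. *)
Lemma line_count (X : finType) (P : {set X}) (E : {set {set X}})
    (line pos : X -> nat) (len : nat -> nat) (N : nat) :
  {in P &, forall p q, line p = line q -> pos p = pos q -> p = q} ->
  (forall A, A \in E -> exists p q, [/\ [set p; q] = A, p \in P, q \in P,
     line p = line q & [/\ pos q = (pos p).+1, pos q <= len (line p) & N < len (line p)]]) ->
  N * #|E| <= N.+1 * #|[set p in P | 0 < pos p < len (line p) & N < len (line p)]|.
Proof.
move=> inj_pos edgeE; set I := [set p in P | _].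
pose M := (\max_p line p).+1.
have ltM p : line p < M by rewrite ltnS; apply: leq_bigmax.
pose occ l i := [exists p in P, (line p == l) && (pos p == i)].
pose spans A l i := [exists p, exists q, [&& A == [set p; q], p \in P, q \in P,
  line p == l, line q == l, pos p == i & pos q == i.+1]].
have leE: #|E| <= \sum_(l < M | N < len l) \sum_(0 <= i < len l) (occ l i && occ l i.+1).
  have: #|E| <= \sum_(A in E) \sum_(l < M | N < len l) \sum_(0 <= i < len l) spans A l i.
    rewrite -sum1_card; apply: leq_sum => A /edgeE[p [q [defA Pp Pq eq_l [pos_q le_q ltN]]]].
    rewrite (bigD1 (Ordinal (ltM p))) //=.
    rewrite big_mkord (bigD1 (Ordinal (leq_trans (eq_leq (esym pos_q)) le_q))) //=.
    suff ->: spans A (line p) (pos p) by [].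
    apply/existsP; exists p; apply/existsP; exists q.
    by rewrite Pp Pq -eq_l pos_q defA !eqxx.
  move/leq_trans; apply; rewrite exchange_big; apply: leq_sum => l _.
  rewrite exchange_big; apply: leq_sum => i _.
  have [A0 /andP[EA0 span_A0]|noA] := pickP (fun A => (A \in E) && spans A l i); last first.
    by rewrite big1 // => A EA; have := noA A; rewrite EA /= => ->.
  rewrite (bigD1 A0) //= big1 ?addn0 => [|A /andP[_ neqA]].
    rewrite span_A0; case/existsP: span_A0 => p /existsP[q /and5P[_ Pp Pq lp /and3P[lq pp pq]]].
    have ->: occ l i by apply/exists_inP; exists p; rewrite // lp pp.
    by have ->: occ l i.+1 by apply/exists_inP; exists q; rewrite // lq pq.
  apply/eqP; rewrite eqb0; apply: contra neqA.
  case/existsP: span_A0 => p /existsP[q].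
  case/and5P=> /eqP-> Pp Pq /eqP lp /and3P[/eqP lq /eqP pp /eqP pq].
  case/existsP=> p' /existsP[q'].
  case/and5P=> /eqP-> Pp' Pq' /eqP lp' /and3P[/eqP lq' /eqP pp' /eqP pq'].
  have -> : p' = p by apply: inj_pos; rewrite ?lp ?pp.
  by have -> : q' = q by apply: inj_pos; rewrite ?lq ?pq.
have leI: \sum_(p in I) \sum_(l < M | N < len l) \sum_(1 <= i < len l)
      ((line p == l) && (pos p == i)) <= #|I|.
  rewrite -[X in _ <= X]sum1_card; apply: leq_sum => p _.
  have le1 (l : 'I_M) :
      \sum_(1 <= i < len l) ((line p == l) && (pos p == i)) <= (l == Ordinal (ltM p)).
    rewrite -val_eqE /= eq_sym; case: (_ == _) => /=; last by rewrite big1.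
    rewrite (eq_bigr (fun i => if i == pos p then 1 else 0)) => [|i _]; last first.
      by rewrite eq_sym; case: ifP.
    by rewrite -big_mkcond big_nat1_eq; case: ifP.
  apply: (@leq_trans (\sum_(l < M | N < len l) (l == Ordinal (ltM p)))).
    by apply: leq_sum => l _; apply: le1.
  rewrite big_mkcond (bigD1 (Ordinal (ltM p))) //= big1 => [|l /negPf->]; last by case: ifP.
  by rewrite eqxx; case: ifP.
have geI: \sum_(l < M | N < len l) \sum_(1 <= i < len l) occ l i <= #|I|.
  apply: leq_trans leI; rewrite exchange_big; apply: leq_sum => l ltN.
  rewrite exchange_big big_nat_cond [X in _ <= X]big_nat_cond.
  apply: leq_sum => i; rewrite andbT => /andP[i_gt0 lti].
  case occ_li: (occ l i) => //; case/exists_inP: occ_li => p Pp /andP[/eqP lp /eqP pp].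
  have Ip: p \in I by rewrite inE Pp lp pp i_gt0 lti ltN.
  by rewrite (bigD1 p) //= lp pp !eqxx.
apply: leq_trans (leq_mul (leqnn _) leE) (leq_trans _ (leq_mul (leqnn _) geI)).
by rewrite !big_distrr /=; apply: leq_sum => l; apply: path_count.
Qed.

(** * Integer coordinates on the subdivisions *)

(** The factor 2 is for an old vertex x, which survives as the singleton of x and
    must keep its place when the scale doubles. *)
Fixpoint coord (V : finType) (k : nat) : iterset V k.+1 -> V -> nat :=
  match k return iterset V k.+1 -> V -> nat with
  | 0 => fun p v => v \in (p : {set V})
  | k'.+1 => fun p v =>
      (if #|(p : {set iterset V k'.+1})| == 1 then 2 else 1) *
      \sum_(x in (p : {set iterset V k'.+1})) coord x v
  end.

Lemma coord_midpoint (V : finType) (k : nat) (p q : iterset V k.+1) (v : V) :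
  coord ([set p; q] : iterset V k.+2) v = coord p v + coord q v.
Proof.
rewrite /=; have [<-|neq_pq] := eqVneq p q.
  by rewrite setUid cards1 big_set1 /= mul2n addnn.
by rewrite cards2 neq_pq mul1n big_setU1 ?inE //= big_set1.
Qed.

Definition carrier (V : finType) (k : nat) (A : {set iterset V k.+1}) : {set V} :=
  [set v | [exists p in A, 0 < coord p v]].

(** Image in coordinates of a simplex of the (k + 1)-fold subdivision; two
    distinct vertices thus differ by the indicator function of a nonempty proper
    subset of the carrier. The top coordinate must be common to all vertices: it
    is what bounds the number of vertices by that of the carrier. *)
Record is_chain (V : finType) (S : {set {set V}}) (k : nat)
    (A : {set iterset V k.+1}) : Prop := IsChain {
  carrier_mem : carrier A \in S;
  coord_top : exists v, forall p, p \in A -> coord p v = 2 ^ k;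
  coord_le : forall p v, p \in A -> coord p v <= 2 ^ k;
  coord_near : forall p q, p \in A -> q \in A ->
    (forall v, coord p v <= coord q v <= (coord p v).+1) \/
    (forall v, coord q v <= coord p v <= (coord q v).+1) }.

Lemma barycentric_chain (V : finType) (S : {set {set V}}) A :
  is_complex S -> A \in subdivision S 1 -> @is_chain V S 0 A.
Proof.
move=> [S0 _]; rewrite inE => /and3P[/set0Pn[x0 Ax0] /subsetP sAS /forall_inP chA].
have{}chA p q : p \in A -> q \in A -> (p \subset q) || (q \subset p).
  by move=> Ap Aq; exact: (forall_inP (chA p Ap)).
split=> /=.
- case: (arg_maxnP (fun x : {set V} => #|x|) Ax0) => M AM maxM.
  suff ->: carrier A = M by exact: sAS.
  apply/setP=> v; rewrite inE; apply/exists_inP/idP => [[p Ap] | Mv].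
    rewrite /= lt0b; case/orP: (chA _ _ Ap AM) => [/subsetP/(_ v)//|sMp].
    have /eqP->//: M == p by rewrite eqEcard sMp; apply: maxM.
  by exists M; rewrite //= Mv.
- case: (arg_minnP (fun x : {set V} => #|x|) Ax0) => m Am minm.
  have [v mv]: exists v, v \in m.
    by apply/set0Pn; apply: contraNneq S0 => <-; apply: sAS.
  exists v => p Ap; suff ->: v \in p by [].
  case/orP: (chA _ _ Ap Am) => [spm|/subsetP->//].
  by have /eqP->: p == m by rewrite eqEcard spm; apply: minm.
- by move=> p v _; apply: leq_b1.
- move=> p q Ap Aq; case/orP: (chA _ _ Ap Aq) => /subsetP spq; [left|right];
  move=> v; have := spq v; by do 2 case: (v \in _) => //= ; move=> /(_ isT).
Qed.

(** Along a chain the sum of the coordinates over the carrier t strictly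
    increases, but by less than #|t| in all, since the common coordinate 2 ^ k
    does not move. So these sums are distinct modulo #|t|. *)
Lemma card_chain (V : finType) (S : {set {set V}}) k (A : {set iterset V k.+1}) :
  is_chain S A -> {in A &, forall p q, coord p =1 coord q -> p = q} ->
  #|A| <= #|carrier A|.
Proof.
move=> [_ [u uP] _ near] inj.
have [->|[x0 Ax0]] := set_0Vmem A; first by rewrite cards0.
have tu: u \in carrier A.
  by rewrite inE; apply/exists_inP; exists x0; rewrite // uP // expn_gt0.
set t := carrier A in tu *.
have t_gt0: 0 < #|t| by apply/card_gt0P; exists u.
pose total (p : iterset V k.+1) := \sum_(v in t) coord p v.
have ltn_total p q : p \in A -> q \in A -> p != q ->
    (forall v, coord p v <= coord q v <= (coord p v).+1) ->
    total p < total q < total p + #|t|.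
  move=> Ap Aq neq_pq le_pq; apply/andP; split.
    rewrite ltn_neqAle leq_sum ?andbT => [|v _]; last by have /andP[] := le_pq v.
    apply: contra neq_pq; rewrite eq_sym => /eqP eq_tot; apply/eqP/inj => // v.
    have le1 i : i \in t -> coord p i <= coord q i by move=> _; have /andP[] := le_pq i.
    have [tv|] := boolP (v \in t).
      have /leqif_sum: forall i, i \in t -> coord p i <= coord q i ?= iff (coord p i == coord q i).
        by move=> i /le1 le_i; split.
      rewrite -/(total p) -/(total q) eq_tot => -[_]; rewrite eqxx => /esym/forall_inP eqv.
      exact/eqP/eqv.
    rewrite inE => /exists_inPn t'v.
    by have := t'v _ Ap; have := t'v _ Aq; rewrite -!eqn0Ngt => /eqP-> /eqP->.
  rewrite /total (bigD1 u) //= [X in _ < X + _](bigD1 u) //= !uP //.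
  rewrite (cardsD1 u) tu -sum1_card.
  rewrite -addnA ltn_add2l add1n addnS ltnS.
  rewrite (eq_bigl (fun v => (v \in t) && (v != u))) => [|v]; last first.
    by rewrite !inE andbC.
  rewrite [X in _ <= _ + X](eq_bigl (fun v => (v \in t) && (v != u))) => [|v]; last first.
    by rewrite !inE andbC.
  by rewrite -big_split /=; apply: leq_sum => v _; rewrite addn1; have /andP[] := le_pq v.
pose f (p : iterset V k.+1) : 'I_#|t| := Ordinal (ltn_pmod (total p) t_gt0).
suff f_inj: {in A &, injective f} by rewrite -[X in _ <= X]card_ord; apply: leq_card_in f_inj.
have lt_mod x y d : x < y < x + d -> x %% d != y %% d.
  move=> /andP[ltxy ltyd]; apply/negP; rewrite eq_sym eqn_mod_dvd ?(ltnW ltxy) // => /dvdn_leq.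
  by lia.
move=> p q Ap Aq /(congr1 val)/= /eqP; apply: contraTeq => neq_pq.
case: (near p q Ap Aq) => /ltn_total lt_pq; first exact/lt_mod/lt_pq.
by rewrite eq_sym; apply/lt_mod/lt_pq => //; rewrite eq_sym.
Qed.

Lemma card_le2P (X : finType) (v : X) (e : {set X}) :
  v \in e -> #|e| <= 2 -> exists2 p, p \in e & e = [set v; p].
Proof.
move=> ev; rewrite (cardsD1 v) ev ltnS => le1.
have [e0|[p]] := set_0Vmem (e :\ v).
  by exists v => //; rewrite -(setD1K ev) e0 setU0 setUid.
rewrite !inE => /andP[neq_pv ep]; exists p => //.
apply/esym/eqP; rewrite eqEcard cards2 eq_sym neq_pv (cardsD1 v) ev ltnS le1 andbT.
by apply/subsetP=> x; rewrite !inE => /orP[] /eqP->.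
Qed.

(** Two vertices of a small simplex are points of old edges that share an old
    vertex v. In the medial triangle this is because two edges of a triangle
    always meet, and for this the dimension bound is needed. *)
Lemma midpoint_simplexP (X : finType) (K : {set {set X}}) A :
    (forall s, s \in K -> #|s| <= 3) -> A \in midpoint_subdivision K ->
  exists2 s, s \in K & [/\ A != set0, forall e, e \in A -> e != set0 /\ e \subset s &
    forall e f, e \in A -> f \in A -> exists v p q,
      [/\ v \in s, p \in s, q \in s, e = [set v; p] & f = [set v; q]]].
Proof.
move=> dimK; rewrite inE => /andP[A_neq0 /exists_inP[s Ks sA]]; exists s => //.
have common (e f : {set X}) v : v \in e -> v \in f -> e \subset s -> f \subset s ->
    #|e| <= 2 -> #|f| <= 2 ->
    exists v p q, [/\ v \in s, p \in s, q \in s, e = [set v; p] & f = [set v; q]].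
  move=> ev fv /subsetP ses /subsetP sfs /(card_le2P ev)[p ep ->] /(card_le2P fv)[q fq ->].
  by exists v, p, q; split; auto.
case/orP: sA => [/exists_inP[v sv /subsetP sA]|/subsetP sA].
  split=> // [e /sA|e f /sA + /sA]; rewrite !inE.
    by case/and3P=> ve -> _; split=> //; apply/set0Pn; exists v.
  by case/and3P=> ? ? ? /and3P[? ? ?]; apply: (common e f v).
split=> // [e /sA|e f /sA + /sA]; rewrite !inE.
  by case/andP=> -> /eqP e2; split=> //; rewrite -card_gt0 e2.
move=> /andP[ses /eqP e2] /andP[sfs /eqP f2].
have [/eqP|[v]] := set_0Vmem (e :&: f).
  move=> dis; have := dimK s Ks.
  suff: #|e :|: f| <= #|s| by rewrite cardsU (eqP dis) cards0 e2 f2 subn0; lia.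
  by apply: subset_leq_card; rewrite subUset ses.
by rewrite inE => /andP[ev fv]; apply: (common e f v); rewrite ?e2 ?f2.
Qed.

(** Two vertices of a small simplex come from pairs {v, p} and {v, q}, so their
    coordinates differ exactly as those of p and q. For injectivity, the ends of
    an edge are recovered from their sum: they differ by at most 1 everywhere, so
    they are the lower and the upper half of it. *)
Lemma subdivision_coord (V : finType) (S : {set {set V}}) (k : nat) :
    is_complex S -> (forall s, s \in S -> #|s| <= 3) ->
  [/\ forall A, A \in subdivision S k.+1 -> is_chain S A,
      forall A, A \in subdivision S k.+1 -> #|A| <= 3 &
      forall A B (p q : iterset V k.+1), A \in subdivision S k.+1 -> B \in subdivision S k.+1 ->
        p \in A -> q \in B -> coord p =1 coord q -> p = q].
Proof.
move=> S_complex dimS.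
suff [chain inj]: (forall A, A \in subdivision S k.+1 -> is_chain S A) /\
      (forall A B (p q : iterset V k.+1), A \in subdivision S k.+1 -> B \in subdivision S k.+1 ->
        p \in A -> q \in B -> coord p =1 coord q -> p = q).
  split=> // A KA; have chA := chain A KA.
  apply: leq_trans (card_chain chA _) (dimS _ (carrier_mem chA)).
  by move=> p q Ap Aq; apply: (inj A A).
elim: k => [|k [IHchain IHinj]].
  split=> [A|A B p q _ _ _ _ eq_pq]; first exact: barycentric_chain.
  by apply/setP=> v; have := eq_pq v; rewrite /=; do 2 case: (v \in _).
have IHdim A : A \in subdivision S k.+1 -> #|A| <= 3.
  move=> KA; have chA := IHchain A KA.
  apply: leq_trans (card_chain chA _) (dimS _ (carrier_mem chA)).
  by move=> p q Ap Aq; apply: (IHinj A A).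
split.
  move=> A /(midpoint_simplexP IHdim)[s Ks [A_neq0 sA pairA]].
  have [s_mem [u top_u] s_le s_near] := IHchain s Ks.
  have {}pairA e f : e \in A -> f \in A -> exists v p q, [/\ v \in s, p \in s, q \in s,
      coord (e : iterset V k.+2) =1 (fun w => coord v w + coord p w) &
      coord (f : iterset V k.+2) =1 (fun w => coord v w + coord q w)].
    move=> Ae Af; have [v [p [q [sv sp sq -> ->]]]] := pairA e f Ae Af.
    by exists v, p, q; split=> // w; apply: coord_midpoint.
  have top e : e \in A -> coord (e : iterset V k.+2) u = 2 ^ k.+1.
    move=> Ae; have [v [p [_ [sv sp _ -> _]]]] := pairA e e Ae Ae.
    by rewrite !top_u // addnn -mul2n expnS.
  split.
  - case: S_complex => _ closedS; apply: closedS s_mem _ _.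
      apply/subsetP=> w; rewrite !inE => /exists_inP[e Ae].
      have [v [p [_ [sv sp _ -> _]]]] := pairA e e Ae Ae.
      rewrite addn_gt0 => /orP[] gt0; apply/exists_inP; first by exists v.
      by exists p.
    have /set0Pn[e Ae] := A_neq0.
    by apply/set0Pn; exists u; rewrite inE; apply/exists_inP; exists e; rewrite // top // expn_gt0.
  - by exists u.
  - move=> e w Ae; have [v [p [_ [sv sp _ -> _]]]] := pairA e e Ae Ae.
    by rewrite expnS mul2n -addnn leq_add // s_le.
  move=> e f Ae Af; have [v [p [q [sv sp sq eqe eqf]]]] := pairA e f Ae Af.
  by case: (s_near p q sp sq) => le_pq; [left|right] => w; have := le_pq w;
    rewrite eqe eqf -addnS !leq_add2l.
move=> A B e f /(midpoint_simplexP IHdim)[s Ks [_ _ pairA]].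
move=> /(midpoint_simplexP IHdim)[t Kt [_ _ pairB]].
move=> Ae Bf eq_ef.
have [v [p [_ [sv sp _ def_e _]]]] := pairA e e Ae Ae.
have [w [q [_ [tw tq _ def_f _]]]] := pairB f f Bf Bf.
have {eq_ef} eq_sum x : coord v x + coord p x = coord w x + coord q x.
  by rewrite -!coord_midpoint -def_e -def_f; apply: eq_ef.
have [_ _ _ /(_ v p sv sp) near_s] := IHchain s Ks.
have [_ _ _ /(_ w q tw tq) near_t] := IHchain t Kt.
have inj x y : x \in s -> y \in t -> coord x =1 coord y -> x = y by exact: IHinj Ks Kt.
suff [[eq1 eq2]|[eq1 eq2]]: (coord v =1 coord w /\ coord p =1 coord q) \/
    (coord v =1 coord q /\ coord p =1 coord w).
- by rewrite def_e def_f (inj v w) // (inj p q).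
- by rewrite def_e def_f (inj v q) // (inj p w) // setUC.
have halves m n m' n' : m <= n <= m.+1 -> m' <= n' <= m'.+1 -> m + n = m' + n' ->
    m = m' /\ n = n' by lia.
(* The ends v, p of one edge match the ends w, q of the other in the order in
   which the two chains go up. *)
case: near_s near_t => le1 [] le2; [left|right|right|left]; split=> x.
- by have [] := halves _ _ _ _ (le1 x) (le2 x) (eq_sum x).
- by have [] := halves _ _ _ _ (le1 x) (le2 x) (eq_sum x).
- by have [] := halves _ _ _ _ (le1 x) (le2 x) (etrans (eq_sum x) (addnC _ _)).
- by have [] := halves _ _ _ _ (le1 x) (le2 x) (etrans (eq_sum x) (addnC _ _)).
- by have [] := halves _ _ _ _ (le1 x) (le2 x) (etrans (addnC _ _) (eq_sum x)).
- by have [] := halves _ _ _ _ (le1 x) (le2 x) (etrans (addnC _ _) (eq_sum x)).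
- by have [] := halves _ _ _ _ (le1 x) (le2 x) (etrans (addnC _ _) (etrans (eq_sum x) (addnC _ _))).
- by have [] := halves _ _ _ _ (le1 x) (le2 x) (etrans (addnC _ _) (etrans (eq_sum x) (addnC _ _))).
Qed.

(** * Lines in the hexagon *)

(** Coordinates up to a common constant: the points of the triangular lattice in
    the hexagon of side N, each represented by its triple with maximum N. *)
Definition on_hexagon (N a b c : nat) :=
  [&& a <= N, b <= N, c <= N & [|| a == N, b == N | c == N]].

(** The lines of one direction are the level sets of b - c, shifted by N to stay
    in nat. *)
Definition hex_line (N b c : nat) := N + b - c.

(** Going forward on a line means to raise a or, once a is N, to lower both b
    and c. *)
Definition hex_pos (N a b c : nat) := N + a - maxn b c.

(** The line b - c = d has 2 N - |d| steps, so that only the two sides of the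
    hexagon in this direction have as few as N. *)
Definition hex_len (N l : nat) := 2 * N - ((l - N) + (N - l)).

Lemma hex_inj N a b c a' b' c' : on_hexagon N a b c -> on_hexagon N a' b' c' ->
  hex_line N b c = hex_line N b' c' -> hex_pos N a b c = hex_pos N a' b' c' ->
  [/\ a = a', b = b' & c = c'].
Proof.
rewrite /hex_line /hex_pos => /and4P[? ? ? top] /and4P[? ? ? top'] ? ?.
by case/or3P: top => /eqP ?; case/or3P: top' => /eqP ?; split; lia.
Qed.

Lemma hex_inner N a b c : on_hexagon N a b c ->
  0 < hex_pos N a b c < hex_len N (hex_line N b c) -> N < hex_len N (hex_line N b c) ->
  [/\ 0 < a, 0 < b & 0 < c].
Proof.
rewrite /hex_line /hex_pos /hex_len => /and4P[? ? ? top] /andP[? ?] ?.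
by case/or3P: top => /eqP ?; split; lia.
Qed.

(** A step along a line cannot raise all three coordinates, one of them being N
    already; the condition on b - c then leaves two possibilities. *)
Lemma hex_parallel N a b c a' b' c' : on_hexagon N a b c -> on_hexagon N a' b' c' ->
    a <= a' <= a.+1 -> b <= b' <= b.+1 -> c <= c' <= c.+1 ->
    (a, b, c) != (a', b', c') -> b + c' = b' + c ->
  a' = a.+1 /\ b' = b /\ c' = c \/ a' = a /\ b' = b.+1 /\ c' = c.+1.
Proof.
rewrite !xpair_eqE => hexp hexq le_a le_b le_c neq par.
have {neq}: a <> a' \/ b <> b' by case/nandP: neq => [/nandP[]|] /eqP; lia.
by case/and4P: hexp => ? ? ? /or3P[] /eqP ?; case/and4P: hexq => ? ? ? _; lia.
Qed.

(** The positivity hypotheses say that the edge lies in no side of the hexagon;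
    they force |b - c| < N, hence a line with more than N steps. *)
Lemma hex_step N a b c a' b' c' : on_hexagon N a b c -> on_hexagon N a' b' c' ->
    a <= a' <= a.+1 -> b <= b' <= b.+1 -> c <= c' <= c.+1 ->
    0 < a' -> 0 < b' -> 0 < c' -> (a, b, c) != (a', b', c') -> b + c' = b' + c ->
  [/\ hex_line N b c = hex_line N b' c', N < hex_len N (hex_line N b c) &
      (hex_pos N a' b' c' = (hex_pos N a b c).+1 /\
        hex_pos N a' b' c' <= hex_len N (hex_line N b c)) \/
      (hex_pos N a b c = (hex_pos N a' b' c').+1 /\
        hex_pos N a b c <= hex_len N (hex_line N b c))].
Proof.
move=> hexp hexq le_a le_b le_c a_gt0 b_gt0 c_gt0 neq par.
have [[def_a [def_b def_c]]|[def_a [def_b def_c]]] :=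
    hex_parallel hexp hexq le_a le_b le_c neq par.
- rewrite def_a def_b def_c in hexq le_a le_b le_c a_gt0 b_gt0 c_gt0 *.
  rewrite /hex_line /hex_pos /hex_len; split=> //; last left;
  by case/and4P: hexp hexq => _ leb lec top /and4P[lea _ _ _]; case/or3P: top => /eqP; lia.
rewrite def_a def_b def_c in hexq le_a le_b le_c a_gt0 b_gt0 c_gt0 *.
rewrite /hex_line /hex_pos /hex_len; split; last right;
by case/and4P: hexp hexq => lea _ _ top /and4P[_ leb lec _]; case/or3P: top => /eqP; lia.
Qed.

(** * Edges along one direction *)

Lemma carrierP (V : finType) (k : nat) (A : {set iterset V k.+1}) (v : V) :
  reflect (exists2 p, p \in A & 0 < coord p v) (v \in carrier A).
Proof. by rewrite inE; apply: exists_inP. Qed.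

Lemma carrier1 (V : finType) (k : nat) (p : iterset V k.+1) (v : V) :
  (v \in carrier [set p]) = (0 < coord p v).
Proof.
apply/carrierP/idP => [[q /set1P->]//|]; by exists p; rewrite ?set11.
Qed.

Lemma carrier_sub (V : finType) (k : nat) (A B : {set iterset V k.+1}) :
  A \subset B -> carrier A \subset carrier B.
Proof.
by move/subsetP=> sAB; apply/subsetP=> v /carrierP[p /sAB Bp gt0]; apply/carrierP; exists p.
Qed.

Lemma coord_out (V : finType) (k : nat) (A : {set iterset V k.+1}) p v :
  p \in A -> v \notin carrier A -> coord p v = 0.
Proof. by move=> Ap; apply: contraNeq; rewrite -lt0n => gt0; apply/carrierP; exists p. Qed.

Lemma chain_top3 (V : finType) (S : {set {set V}}) k (A : {set iterset V k.+1}) a b c :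
  is_chain S A -> carrier A \subset [set a; b; c] -> 
  [\/ {in A, forall p, coord p a = 2 ^ k}, {in A, forall p, coord p b = 2 ^ k} |
      {in A, forall p, coord p c = 2 ^ k}].
Proof.
move=> [_ [u top_u] _ _] sub.
have [->|[p0 Ap0]] := set_0Vmem A; first by constructor 1 => p; rewrite inE.
have: u \in [set a; b; c].
  by apply: (subsetP sub); apply/carrierP; exists p0; rewrite // top_u // expn_gt0.
by rewrite !inE => /orP[/orP[]|] /eqP def_u; rewrite def_u in top_u;
  [constructor 1|constructor 2|constructor 3].
Qed.

Lemma eq_coord3 (V : finType) k (A B : {set iterset V k.+1}) a b c p q :
    p \in A -> q \in B -> carrier A \subset [set a; b; c] -> carrier B \subset [set a; b; c] ->
    coord p a = coord q a -> coord p b = coord q b -> coord p c = coord q c -> coord p =1 coord q.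
Proof.
move=> Ap Bq /subsetP subA /subsetP subB eqa eqb eqc v.
have [|tv] := boolP (v \in [set a; b; c]).
  by rewrite !inE => /orP[/orP[]|] /eqP->.
by rewrite (coord_out Ap) ?(coord_out Bq) //; apply: contra tv; auto.
Qed.

(** The edges along the lines on which b - c is constant. *)
Definition parallel (V : finType) (k : nat) (b c : V) (A : {set iterset V k.+1}) :=
  [forall p in A, forall q in A, coord p b + coord q c == coord q b + coord p c].

Lemma parallelP (V : finType) (k : nat) (b c : V) (A : {set iterset V k.+1}) :
  reflect {in A &, forall p q, coord p b + coord q c = coord q b + coord p c} (parallel b c A).
Proof.
apply: (iffP forall_inP) => [par p q Ap Aq|par p Ap].
  by apply/eqP; apply: (forall_inP (par p Ap)).
by apply/forall_inP=> q Aq; apply/eqP/par.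
Qed.

Lemma chain_on_hexagon (V : finType) (S : {set {set V}}) k (A : {set iterset V k.+1}) a b c p :
  is_chain S A -> carrier A \subset [set a; b; c] -> p \in A ->
  on_hexagon (2 ^ k) (coord p a) (coord p b) (coord p c).
Proof.
move=> chA sub Ap; rewrite /on_hexagon !(coord_le chA) //=.
by case: (chain_top3 chA sub) => top; rewrite top ?eqxx ?orbT.
Qed.

Definition near3 (V : finType) (k : nat) a b c (p q : iterset V k.+1) :=
  [&& coord p a <= coord q a <= (coord p a).+1,
      coord p b <= coord q b <= (coord p b).+1,
      coord p c <= coord q c <= (coord p c).+1 &
      (coord p a, coord p b, coord p c) != (coord q a, coord q b, coord q c)].

Lemma chain_near3 (V : finType) (S : {set {set V}}) k (A : {set iterset V k.+1}) a b c p q :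
    is_chain S A -> {in A &, forall p q, coord p =1 coord q -> p = q} ->
    carrier A \subset [set a; b; c] -> p \in A -> q \in A -> p != q ->
  near3 a b c p q || near3 a b c q p.
Proof.
move=> chA inj sub Ap Aq neq_pq.
have neq: (coord p a, coord p b, coord p c) != (coord q a, coord q b, coord q c).
  by apply: contra neq_pq => /eqP[eqa eqb eqc]; apply/eqP/inj => //; apply: (eq_coord3 Ap Aq sub sub).
rewrite /near3 (eq_sym (coord q a, _, _)) neq.
by case: (coord_near chA Ap Aq) => near; rewrite !near ?orbT.
Qed.

(** The count on lines, read in the hexagon over {a, b, c}: a line which is not a
    side has its inner points in the interior of the hexagon, and an edge with
    carrier {a, b, c} is never on a side. The three vertices may coincide: if
    b = c, the hexagon degenerates to the broken line over an edge {a, b} of S,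
    and the statement is still the right one. *)
Lemma direction_count (V : finType) (S : {set {set V}}) k a b c
    (P : {set iterset V k.+1}) (E : {set {set iterset V k.+1}}) :
    is_complex S -> (forall s, s \in S -> #|s| <= 3) ->
    (forall p, p \in P -> [set p] \in subdivision S k.+1 /\
       carrier [set p] \subset [set a; b; c]) ->
    (forall A, A \in E -> [/\ A \in subdivision S k.+1, A \subset P, #|A| = 2,
       carrier A = [set a; b; c] & parallel b c A]) ->
  2 ^ k * #|E| <= (2 ^ k).+1 * #|[set p in P | carrier [set p] == [set a; b; c]]|.
Proof.
move=> S_complex dimS P_in E_in.
have [chain _ inj] := subdivision_coord k S_complex dimS.
pose line (p : iterset V k.+1) := hex_line (2 ^ k) (coord p b) (coord p c).
pose pos (p : iterset V k.+1) := hex_pos (2 ^ k) (coord p a) (coord p b) (coord p c).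
have hexP p : p \in P -> on_hexagon (2 ^ k) (coord p a) (coord p b) (coord p c).
  by case/P_in=> Kp sub; apply: chain_on_hexagon (chain _ Kp) sub (set11 p).
have inj_pos: {in P &, forall p q, line p = line q -> pos p = pos q -> p = q}.
  move=> p q Pp Pq eq_line eq_pos.
  have [[Kp subp] [Kq subq]] := (P_in p Pp, P_in q Pq).
  have [eqa eqb eqc] := hex_inj (hexP p Pp) (hexP q Pq) eq_line eq_pos.
  apply: (inj [set p] [set q]); rewrite ?set11 //.
  exact: (eq_coord3 (set11 p) (set11 q) subp subq).
have stepE A : A \in E -> exists p q, [/\ [set p; q] = A, p \in P, q \in P, line p = line q &
    [/\ pos q = (pos p).+1, pos q <= hex_len (2 ^ k) (line p) & 2 ^ k < hex_len (2 ^ k) (line p)]].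
  case/E_in=> KA /subsetP sAP cardA carA /parallelP par.
  have /cards2P[x [y [neq_xy defA]]] := introT eqP cardA.
  have inA: x \in A /\ y \in A by rewrite defA !inE !eqxx orbT.
  wlog near: x y neq_xy defA inA / near3 a b c x y.
    move=> IH; have [Ax Ay] := inA.
    have injA: {in A &, forall p q, coord p =1 coord q -> p = q} by move=> p q; apply: inj.
    have subA: carrier A \subset [set a; b; c] by rewrite carA.
    case/orP: (chain_near3 (chain A KA) injA subA Ax Ay neq_xy) => near.
      exact: (IH x y).
    by apply: (IH y x); rewrite // 1?eq_sym // setUC.
  have [Ax Ay] := inA; case/and4P: near => na nb nc neq.
  have gt0 v : v \in [set a; b; c] -> coord x v <= coord y v <= (coord x v).+1 -> 0 < coord y v.
    rewrite -carA => /carrierP[z]; rewrite defA !inE => /orP[] /eqP-> // gt0 /andP[le_xy _].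
    exact: leq_trans le_xy.
  have [|||eq_line ltN [[pos_y le_y]|[pos_x le_x]]] :=
      hex_step (hexP x (sAP x Ax)) (hexP y (sAP y Ay)) na nb nc _ _ _ neq (par x y Ax Ay).
  - by apply: gt0 na; rewrite !inE eqxx.
  - by apply: gt0 nb; rewrite !inE eqxx !orbT.
  - by apply: gt0 nc; rewrite !inE eqxx !orbT.
  - by exists x, y; rewrite !sAP.
  by exists y, x; rewrite !sAP // setUC -/(line y) /line -eq_line.
apply: leq_trans (line_count inj_pos stepE) _; rewrite leq_mul2l; apply/orP; right.
apply/subset_leq_card/subsetP=> p; rewrite !inE => /and3P[Pp pos_in ltN]; rewrite Pp /=.
have [_ subp] := P_in p Pp; rewrite eqEsubset subp; apply/subsetP=> v.
have [a_gt0 b_gt0 c_gt0] := hex_inner (hexP p Pp) pos_in ltN.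
by rewrite carrier1 !inE => /orP[/orP[]|] /eqP->.
Qed.

Lemma parallel2 (V : finType) (k : nat) (b c : V) (x y : iterset V k.+1) :
  parallel b c [set x; y] = (coord x b + coord y c == coord y b + coord x c).
Proof.
apply/parallelP/eqP => [par|par p q]; first by apply: par; rewrite !inE eqxx ?orbT.
by rewrite !inE => /orP[] /eqP-> /orP[] /eqP->.
Qed.

Definition faces (V : finType) (k i : nat) (T : {set {set iterset V k.+1}}) (t : {set V}) :=
  [set A in T | (#|A| == i.+1) && (carrier A == t)].

Lemma parallel_edges_count (V : finType) (S : {set {set V}}) k a b c
    (T : {set {set iterset V k.+1}}) :
    is_complex S -> (forall s, s \in S -> #|s| <= 3) -> subcomplex T (subdivision S k.+1) ->
  2 ^ k * #|[set A in faces 1 T [set a; b; c] | parallel b c A]| <=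
    (2 ^ k).+1 * #|faces 0 T [set a; b; c]|.
Proof.
move=> S_complex dimS [[T0 closedT] /subsetP sTK]; set t := [set a; b; c].
pose P := [set p | ([set p] \in T) && (carrier [set p] \subset t)].
have P_in p : p \in P -> [set p] \in subdivision S k.+1 /\ carrier [set p] \subset t.
  by rewrite inE => /andP[/sTK].
apply: leq_trans (direction_count S_complex dimS P_in _) _.
  move=> A; rewrite !inE => /andP[/and3P[TA /eqP cardA /eqP carA] par].
  split=> //; first exact: sTK.
  apply/subsetP=> p Ap; rewrite inE -carA carrier_sub ?sub1set // andbT.
  by apply: closedT TA _ _; rewrite ?sub1set // -card_gt0 cards1.
rewrite leq_mul2l -(card_imset _ (@set1_inj _)); apply/orP; right.
apply/subset_leq_card/subsetP=> A /imsetP[p]; rewrite !inE => /andP[/andP[Tp _] car_p] ->.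
by rewrite Tp cards1.
Qed.

(** Between the ends of an edge each coordinate moves by 0 or 1, all in the same
    sense, so two of the three move alike. *)
Lemma edge_directions (V : finType) (S : {set {set V}}) k a b c (A : {set iterset V k.+1}) :
    is_chain S A -> {in A &, forall p q, coord p =1 coord q -> p = q} ->
    carrier A \subset [set a; b; c] -> #|A| = 2 ->
  [|| parallel b c A, parallel a c A | parallel a b A].
Proof.
move=> chA inj sub /eqP/cards2P[x [y [neq_xy defA]]].
have [Ax Ay]: x \in A /\ y \in A by rewrite defA !inE !eqxx orbT.
have := chain_near3 chA inj sub Ax Ay neq_xy; rewrite defA !parallel2 /near3 => {}near.
have pigeon xa xb xc ya yb yc : xa <= ya <= xa.+1 -> xb <= yb <= xb.+1 -> xc <= yc <= xc.+1 ->
  [|| xb + yc == yb + xc, xa + yc == ya + xc | xa + yb == ya + xb].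
  by move=> ? ? ?; apply/or3P; case: (eqVneq ya xa) (eqVneq yb xb) (eqVneq yc xc) => ? [] ? [] ?;
    solve [constructor 1; lia|constructor 2; lia|constructor 3; lia].
case/orP: near => /and4P[? ? ? _]; first exact: pigeon.
by rewrite ![coord x _ + _ == _]eq_sym; apply: pigeon.
Qed.

Lemma edge_count (V : finType) (S : {set {set V}}) k a b c
    (T : {set {set iterset V k.+1}}) :
    is_complex S -> (forall s, s \in S -> #|s| <= 3) -> subcomplex T (subdivision S k.+1) ->
  2 ^ k * #|faces 1 T [set a; b; c]| <= 3 * (2 ^ k).+1 * #|faces 0 T [set a; b; c]|.
Proof.
move=> S_complex dimS subT; set t := [set a; b; c]; have [_ /subsetP sTK] := subT.
have [chain _ inj] := subdivision_coord k S_complex dimS.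
have dir_bc := parallel_edges_count a b c S_complex dimS subT.
have dir_ac := parallel_edges_count b a c S_complex dimS subT.
have dir_ab := parallel_edges_count c a b S_complex dimS subT.
have eq_bac: [set b; a; c] = t by apply/setP=> v; rewrite !inE [(v == b) || _]orbC.
have eq_cab: [set c; a; b] = t by apply/setP=> v; rewrite !inE -orbA orbC.
rewrite -/t in dir_bc; rewrite eq_bac in dir_ac; rewrite eq_cab in dir_ab.
have cover3: #|faces 1 T t| <= #|[set A in faces 1 T t | parallel b c A]| +
    #|[set A in faces 1 T t | parallel a c A]| + #|[set A in faces 1 T t | parallel a b A]|.
  set U := [set A in _ | parallel b c A]; set U' := [set A in _ | parallel a c A].
  set U'' := [set A in _ | parallel a b A].
  apply: (@leq_trans #|U :|: U' :|: U''|); last first.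
    by apply: leq_trans (leq_card_setU _ _) _; rewrite leq_add2r leq_card_setU.
  apply/subset_leq_card/subsetP=> A FA.
  rewrite !inE -!andb_orr -orbA; move: FA; rewrite inE => /and3P[TA cardA carA].
  rewrite TA cardA carA /=.
  have chA := chain A (sTK A TA); apply: (edge_directions chA); last exact/eqP.
    by move=> p q; apply: inj; apply: sTK.
  by rewrite (eqP carA).
by apply: leq_trans (leq_mul (leqnn _) cover3) _; lia.
Qed.

(** * Triangles as steps along strips *)

Lemma card3P (X : finType) (s : {set X}) : #|s| = 3 ->
  exists x y z, [/\ x != y, x != z, y != z & s = [set x; y; z]].
Proof.
move=> s3; have /card_gt0P[x sx]: 0 < #|s| by rewrite s3.
have /eqP/cards2P[y [z [neq_yz def_s]]]: #|s :\ x| = 2 by move: s3; rewrite (cardsD1 x) sx => -[].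
have: (y \in s :\ x) && (z \in s :\ x) by rewrite def_s !inE !eqxx orbT.
rewrite !inE => /andP[/andP[neq_yx _] /andP[neq_zx _]].
exists x, y, z; rewrite ![x == _]eq_sym; split=> //.
by rewrite -(setD1K sx) def_s setUA.
Qed.

(** By [hex_parallel] exactly one of a and b moves, by one. *)
Lemma parallel_pair_parity (V : finType) (S : {set {set V}}) k (A : {set iterset V k.+1}) a b c p q :
    is_chain S A -> {in A &, forall p q, coord p =1 coord q -> p = q} ->
    carrier A \subset [set a; b; c] -> p \in A -> q \in A -> p != q ->
    parallel b c [set p; q] ->
  odd (coord p a + coord p b) != odd (coord q a + coord q b).
Proof.
move=> chA inj sub Ap Aq neq_pq; rewrite parallel2 => /eqP par.
have [hexp hexq] := (chain_on_hexagon chA sub Ap, chain_on_hexagon chA sub Aq).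
case/orP: (chain_near3 chA inj sub Ap Aq neq_pq) => /and4P[na nb nc neq].
  by case: (hex_parallel hexp hexq na nb nc neq par) => [] [-> [-> _]];
    rewrite ?addSn ?addnS /=; case: (odd _).
by case: (hex_parallel hexq hexp na nb nc neq (esym par)) => [] [-> [-> _]];
  rewrite ?addSn ?addnS /=; case: (odd _).
Qed.

(** Parallelism is transitive, so either exactly one side of the triangle is
    parallel to the chosen direction or all three or none are. Three is excluded
    by parity, and none because b - c takes at most two values on a chain. *)
Lemma triangle_apex (V : finType) (S : {set {set V}}) k (A : {set iterset V k.+1}) a b c :
    is_chain S A -> {in A &, forall p q, coord p =1 coord q -> p = q} ->
    carrier A \subset [set a; b; c] -> #|A| = 3 ->
  exists v p q, [/\ [/\ v != p, v != q & p != q], A = [set v; p; q],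
    parallel b c [set p; q] & ~~ parallel b c [set v; p] && ~~ parallel b c [set v; q]].
Proof.
move=> chA inj sub /card3P[x [y [z [nxy nxz nyz defA]]]].
have [Ax Ay Az]: [/\ x \in A, y \in A & z \in A] by rewrite defA !inE !eqxx !orbT.
have par_sym (p q : iterset V k.+1) :
    parallel b c [set p; q] = parallel b c [set q; p] by rewrite setUC.
have par_trans (p q r : iterset V k.+1) :
    parallel b c [set p; q] -> parallel b c [set q; r] -> parallel b c [set p; r].
  by rewrite !parallel2 => /eqP ? /eqP ?; apply/eqP; lia.
have not_all: ~~ [&& parallel b c [set x; y], parallel b c [set x; z] & parallel b c [set y; z]].
  apply/negP=> /and3P[pxy pxz pyz].
  have := parallel_pair_parity chA inj sub Ax Ay nxy pxy.
  have := parallel_pair_parity chA inj sub Ax Az nxz pxz.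
  have := parallel_pair_parity chA inj sub Ay Az nyz pyz.
  by do 3 case: (odd _).
have some: [|| parallel b c [set x; y], parallel b c [set x; z] | parallel b c [set y; z]].
  have near_bc p q : p \in A -> q \in A ->
      coord p b <= coord q b <= (coord p b).+1 /\ coord p c <= coord q c <= (coord p c).+1 \/
      coord q b <= coord p b <= (coord q b).+1 /\ coord q c <= coord p c <= (coord q c).+1.
    by move=> Ap Aq; case: (coord_near chA Ap Aq) => near; [left|right]; split.
  rewrite !parallel2; move: (near_bc x y Ax Ay) (near_bc x z Ax Az) (near_bc y z Ay Az).
  by move: (coord x b) (coord y b) (coord z b) (coord x c) (coord y c) (coord z c); lia.
have [pxy|npxy] := boolP (parallel b c [set x; y]).
  exists z, x, y; rewrite !(eq_sym z); split=> //; first by rewrite defA setUC setUA.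
  rewrite pxy in not_all; rewrite !(par_sym z).
  have [pxz|npxz] := boolP (parallel b c [set x; z]).
    by rewrite pxz (par_trans y x z) ?(par_sym y) in not_all.
  by rewrite /=; apply: contra npxz => pyz; apply: par_trans pyz.
have [pxz|npxz] := boolP (parallel b c [set x; z]).
  exists y, x, z; rewrite (eq_sym y x); split=> //; first by rewrite defA [[set y; x]]setUC.
  rewrite (par_sym y) npxy /=; apply: contra npxy => pyz.
  by apply: (par_trans x z y); rewrite // par_sym.
by exists x, y, z; rewrite npxy npxz; split=> //; move: some; rewrite (negPf npxy) (negPf npxz).
Qed.

(** Seen as a set of vertices of the next subdivision, this is the edge joining
    the midpoints of the two sides of the triangle that cross its strip. *)
Definition transversal_edges (V : finType) (k : nat) (b c : V) (A : {set iterset V k.+1}) :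
    {set iterset V k.+2} :=
  [set e in medial A | ~~ parallel b c e].

Lemma transversal_edgesE (V : finType) (k : nat) (b c : V) (v p q : iterset V k.+1) :
    v != p -> v != q -> parallel b c [set p; q] ->
    ~~ parallel b c [set v; p] -> ~~ parallel b c [set v; q] ->
  transversal_edges b c [set v; p; q] = [set [set v; p]; [set v; q]].
Proof.
move=> neq_vp neq_vq par_pq npar_vp npar_vq; apply/setP=> e; rewrite !inE.
apply/idP/orP=> [/andP[/andP[/subsetP sub /cards2P[x [y [neq_xy def_e]]]] npar]|]; last first.
  case=> /eqP->; rewrite ?npar_vp ?npar_vq cards2 ?neq_vp ?neq_vq andbT andbT.
    by apply/subsetP=> x; rewrite !inE => /orP[] ->; rewrite ?orbT.
  by apply/subsetP=> x; rewrite !inE => /orP[] ->; rewrite ?orbT.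
have: (x \in [set v; p; q]) && (y \in [set v; p; q]).
  by rewrite !sub // def_e !inE eqxx ?orbT.
rewrite !inE => /andP[x_in y_in]; rewrite def_e in npar *.
case/orP: x_in neq_xy npar => [/orP[]|] /eqP->; case/orP: y_in => [/orP[]|] /eqP->;
  rewrite ?eqxx // => _ npar; rewrite ?[[set _; v]]setUC ?eqxx; auto.
- by rewrite par_pq in npar.
- by rewrite setUC par_pq in npar.
Qed.

Lemma carrier_midpoints (V : finType) (k : nat) (A : {set iterset V k.+2}) :
  (forall e, e \in A -> #|(e : {set iterset V k.+1})| = 2) ->
  carrier A = carrier (cover (A : {set {set iterset V k.+1}})).
Proof.
move=> card2; apply/setP=> v; apply/carrierP/carrierP => [[e Ae]|[p /bigcupP[e Ae ep] gt0]].
  have /eqP/cards2P[p [q [_ def_e]]] := card2 e Ae.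
  have := Ae; rewrite {2}def_e coord_midpoint addn_gt0 => + /orP[] gt0.
    by exists p => //; apply/bigcupP; exists e; rewrite // def_e !inE eqxx.
  by exists q => //; apply/bigcupP; exists e; rewrite // def_e !inE eqxx orbT.
exists e => //; have /eqP/cards2P[x [y [_ def_e]]] := card2 e Ae.
move: ep; rewrite def_e coord_midpoint addn_gt0 !inE => /orP[] /eqP <-; by rewrite gt0 ?orbT.
Qed.

(** The midlines of the strips are lines of the next subdivision, so
    [direction_count] applies there: its vertices are the midpoints of the edges
    of T that are not parallel to the chosen direction, and its edges are the
    segments joining such midpoints inside a triangle of T. Each of these
    vertices comes from an edge of one of the two remaining directions, to which
    [parallel_edges_count] applies. *)
Lemma triangle_count (V : finType) (S : {set {set V}}) k a b c
    (T : {set {set iterset V k.+1}}) :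
    is_complex S -> (forall s, s \in S -> #|s| <= 3) -> subcomplex T (subdivision S k.+1) ->
  (2 ^ k) ^ 2 * #|faces 2 T [set a; b; c]| <=
    (2 ^ k.+1).+1 * (2 ^ k).+1 * #|faces 0 T [set a; b; c]|.
Proof.
move=> S_complex dimS subT; set t := [set a; b; c].
have [[_ closedT] /subsetP sTK] := subT.
have [chain _ inj] := subdivision_coord k S_complex dimS.
pose P : {set iterset V k.+2} :=
  [set e in T | [&& #|e| == 2, carrier e \subset t & ~~ parallel b c e]].
pose E := [set transversal_edges b c A | A in faces 2 T t].
have carrier_edge (e : iterset V k.+2) : #|(e : {set iterset V k.+1})| = 2 ->
    carrier [set e] = carrier (e : {set iterset V k.+1}).
  move=> e2; rewrite carrier_midpoints => [|f /set1P->//].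
  by rewrite /cover big_set1.
have apex A : A \in faces 2 T t -> exists v p q,
    [/\ [/\ v != p, v != q & p != q], A = [set v; p; q],
    parallel b c [set p; q], ~~ parallel b c [set v; p] & ~~ parallel b c [set v; q]].
  rewrite inE => /and3P[TA /eqP A3 /eqP carA].
  have injA: {in A &, forall p q, coord p =1 coord q -> p = q}.
    by move=> p q; apply: inj; apply: sTK.
  have subA: carrier A \subset t by rewrite carA.
  have [v [p [q [neq defA par /andP[? ?]]]]] := triangle_apex (chain A (sTK A TA)) injA subA A3.
  by exists v, p, q.
have cover_trans A : A \in faces 2 T t -> cover (transversal_edges b c A) = A.
  case/apex=> v [p [q [[neq_vp neq_vq neq_pq] -> par np nq]]].
  rewrite transversal_edgesE // /cover big_setU1 ?big_set1 /=; last first.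
    rewrite inE; apply: contra neq_pq => /eqP/setP/(_ p); rewrite !inE eqxx orbT.
    by rewrite [p == v]eq_sym (negPf neq_vp).
  by apply/setP=> x; rewrite !inE; case: (x == v) => //=; case: (x == p).
have injE: {in faces 2 T t &, injective (@transversal_edges V k b c)}.
  by move=> A B FA FB eqAB; rewrite -(cover_trans A FA) eqAB cover_trans.
have P_in e : e \in P -> [set e] \in subdivision S k.+2 /\ carrier [set e] \subset t.
  rewrite inE => /and4P[Te e2 sub _]; rewrite carrier_edge ?(eqP e2) //; split=> //.
  rewrite /= inE -card_gt0 cards1; apply/exists_inP; exists e; first exact: sTK.
  by apply/orP; right; rewrite sub1set inE subxx.
have E_in A : A \in E -> [/\ A \in subdivision S k.+2, A \subset P, #|A| = 2,
    carrier A = t & parallel b c A].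
  case/imsetP=> s Fs defA; have := cover_trans s Fs.
  have [v [p [q [[neq_vp neq_vq neq_pq] def_s par np nq]]]] := apex s Fs.
  have := Fs; rewrite inE => /and3P[Ts _ /eqP car_s].
  have defA2: A = [set [set v; p]; [set v; q]] by rewrite defA def_s transversal_edgesE.
  rewrite -defA => cover_A.
  have A_med : A \subset medial s by rewrite defA; apply/subsetP=> e; rewrite inE => /andP[].
  have card_e e : e \in A -> #|(e : {set iterset V k.+1})| = 2.
    by move/(subsetP A_med); rewrite inE => /andP[_ /eqP].
  split.
  - rewrite /= inE; apply/andP; split.
      by apply/set0Pn; exists [set v; p]; rewrite defA2 !inE eqxx.
    by apply/exists_inP; exists s; [exact: sTK|rewrite A_med orbT].
  - apply/subsetP=> e Ae; have := Ae; rewrite defA !inE => /andP[/andP[ses e2] ->].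
    rewrite e2 /= andbT (closedT s) // -?card_gt0 ?(eqP e2) //=.
    by rewrite -car_s carrier_sub.
  - rewrite defA2 cards2; suff ->: [set v; p] != [set v; q] by [].
    apply: contra neq_pq => /eqP/setP/(_ p); rewrite !inE eqxx orbT.
    by rewrite [p == v]eq_sym (negPf neq_vp).
  - by rewrite carrier_midpoints // cover_A.
  rewrite defA2 parallel2 !coord_midpoint.
  by move: par; rewrite parallel2 => /eqP; lia.
have strips := direction_count S_complex dimS P_in E_in.
rewrite (card_in_imset injE) in strips.
set Q := [set p in P | _] in strips.
have dir_ac := parallel_edges_count b a c S_complex dimS subT.
have dir_ab := parallel_edges_count c a b S_complex dimS subT.
have eq_bac: [set b; a; c] = t by apply/setP=> v; rewrite !inE [(v == b) || _]orbC.
have eq_cab: [set c; a; b] = t by apply/setP=> v; rewrite !inE -orbA orbC.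
rewrite eq_bac in dir_ac; rewrite eq_cab in dir_ab.
have leQ: #|Q| <= #|[set A in faces 1 T t | parallel a c A]| +
    #|[set A in faces 1 T t | parallel a b A]|.
  apply: leq_trans (leq_card_setU _ _).
  apply/subset_leq_card/subsetP=> e; rewrite [e \in Q]inE [e \in P]inE.
  case/andP=> /and4P[Te e2 sub npar]; rewrite carrier_edge ?(eqP e2) // => /eqP car_e.
  rewrite !inE Te e2 car_e eqxx /=.
  have injA: {in e &, forall p q, coord p =1 coord q -> p = q}.
    by move=> p q; apply: inj; apply: sTK.
  by have := edge_directions (chain e (sTK e Te)) injA sub (eqP e2); rewrite (negPf npar).
move: strips leQ dir_ac dir_ab; rewrite expnS.
move: #|Q| #|[set A in _ | parallel a c A]| #|[set A in _ | parallel a b A]| => x y z.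
by move: #|faces 2 T t| #|faces 0 T t| (2 ^ k) => f2 f0 N ? ? ? ?; nia.
Qed.

(** * Summing over the simplices of S *)

Lemma face_number_carrier (V : finType) (S : {set {set V}}) k i (T : {set {set iterset V k.+1}}) :
    is_complex S -> (forall s, s \in S -> #|s| <= 3) -> subcomplex T (subdivision S k.+1) ->
  face_number i T = \sum_(t in S) #|faces i T t|.
Proof.
move=> S_complex dimS [_ /subsetP sTK].
have [chain _ _] := subdivision_coord k S_complex dimS.
rewrite /face_number -sum1_card (partition_big (@carrier V k) (mem S)) /= => [|A]; last first.
  by rewrite inE => /andP[/sTK/chain/carrier_mem].
apply: eq_bigr => t _; rewrite -sum1_card; apply: eq_bigl => A.
by rewrite !inE andbA.
Qed.

Lemma card_le3P (X : finType) (t : {set X}) :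
  t != set0 -> #|t| <= 3 -> exists a b c, t = [set a; b; c].
Proof.
case/set0Pn=> a ta; rewrite (cardsD1 a) ta ltnS => t2.
have [t0|[b tb]] := set_0Vmem (t :\ a).
  by exists a, a, a; rewrite -(setD1K ta) t0 setU0 !setUid.
by have [c _ def] := card_le2P tb t2; exists a, b, c; rewrite -(setD1K ta) def setUA.
Qed.

Lemma face_bounds (V : finType) (S : {set {set V}}) k (T : {set {set iterset V k.+1}}) :
    is_complex S -> (forall s, s \in S -> #|s| <= 3) -> subcomplex T (subdivision S k.+1) ->
  2 ^ k * face_number 1 T <= 3 * (2 ^ k).+1 * face_number 0 T /\
  (2 ^ k) ^ 2 * face_number 2 T <= (2 ^ k.+1).+1 * (2 ^ k).+1 * face_number 0 T.
Proof.
move=> S_complex dimS subT; rewrite !(face_number_carrier _ S_complex dimS subT) !big_distrr /=.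
have abcP t : t \in S -> exists a b c, t = [set a; b; c].
  move=> St; apply: card_le3P (dimS t St).
  by apply: contraNneq S_complex.1 => <-.
by split; apply: leq_sum => t /abcP[a [b [c ->]]];
  [apply: edge_count dimS subT | apply: triangle_count dimS subT].
Qed.

Local Open Scope ring_scope.

Theorem proposition3p3 (R : realType) (V : finType) (S : {set {set V}})
    (S_complex : is_complex S) (S_dim2 : has_dim 2 S)
    (eps : R) (eps_gt0 : 0 < eps) :
  exists k0 : nat, forall k : nat, (1 <= k)%N -> (k0 <= k)%N ->
    forall T : {set {set iterset V k}}, subcomplex T (subdivision S k) ->
      (face_number 1 T <> 0%N -> mu R 1 T > 1 / 3 - eps) /\
      (face_number 2 T <> 0%N -> mu R 2 T > 1 / 2 - eps).
Proof.
(* Any N = 2 ^ k with eps * N > 1 will do, and 2 ^ k > k. *)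
have [m m_gt] : exists m : nat, eps^-1 < m%:R.
  by exists (Num.truncn eps^-1).+1; apply: truncnS_gt.
exists m.+1 => -[//|k] _; rewrite ltnS => le_mk T subT; rewrite /mu.
have [dimS _] := S_dim2.
have [le1 le2] := face_bounds S_complex dimS subT.
have lt_eps : 1 < eps * (2 ^ k)%N%:R.
  rewrite mulrC -ltr_pdivrMr // div1r; apply: lt_le_trans m_gt _.
  by rewrite ler_nat; apply: leq_trans le_mk (ltnW (ltn_expl k _)).
have N_ge1 : 1 <= (2 ^ k)%N%:R :> R by rewrite ler1n expn_gt0.
have f0_ge0 : 0 <= (face_number 0 T)%:R :> R by [].
have {}le1 : (2 ^ k)%N%:R * (face_number 1 T)%:R <=
    3 * ((2 ^ k)%N%:R + 1) * (face_number 0 T)%:R :> R.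
  by rewrite natr1 -!natrM ler_nat.
have {}le2 : (2 ^ k)%N%:R ^+ 2 * (face_number 2 T)%:R <=
    (2 * (2 ^ k)%N%:R + 1) * ((2 ^ k)%N%:R + 1) * (face_number 0 T)%:R :> R.
  by rewrite -!natrM !natr1 -natrX -!natrM ler_nat -expnS.
move: le1 le2 lt_eps N_ge1 f0_ge0; move: (2 ^ k)%N%:R (face_number 0 T)%:R => N f0.
move=> le1 le2 lt_eps N_ge1 f0_ge0.
split => /eqP; rewrite -lt0n => f_gt0; rewrite ltr_pdivlMr ?ltr0n //;
  move: f_gt0; rewrite -(ltr0n R) => f_gt0.
- have D_gt0 : 0 < 3 * (N + 1) by lra.
  rewrite -(ltr_pM2l D_gt0); apply: lt_le_trans le1.
  by rewrite mulrA ltr_pM2r //; nra.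
have D_gt0 : 0 < (2 * N + 1) * (N + 1) by nra.
rewrite -(ltr_pM2l D_gt0); apply: lt_le_trans le2.
rewrite mulrA ltr_pM2r //.
have ltNN : N < eps * N * N by rewrite ltr_pMl //; lra.
by nra.
Qed.
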